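(* Suppose $\lambda_1>0$ and $\lambda_2=0$, and let $x^*\in\Omega$. Then the following two statements are equivalent: (i) $x^*$ is a local minimizer of the problem $\min_{x\in\Omega} F(x)$, where (since $\lambda_2=0$) $F(x)=f(x)+\lambda_1\|x_+\|_0$; (ii) $x^*$ is a global minimizer of $f$ on the set $\Omega_{s^*}:=\{x\in\Omega : x_i\le 0\ \text{for all } i\in\Gamma^c(x^* )\}$.
   Context: $f:\mathbb{R}^n\to\mathbb{R}$ is a convex differentiable function whose gradient is $L_f$-Lipschitz continuous. $\Omega=\{x\in\mathbb{R}^n: l_i\le x_i\le u_i,\ i=1,\dots,n\}$ with $-\infty\le l_i\le 0\le u_i\le+\infty$ and $l_i<u_i$ for all $i$. For $x\in\mathbb{R}^n$, $\|x_+\|_0$ is the number of indices $i$ with $x_i>0$. $\Gamma(x)=\{i\in\{1,\dots,n\}: x_i\ne 0\}$ and $\Gamma^c(x)=\{1,\dots,n\}\setminus\Gamma(x)$. A local minimizer of $\min_{x\in\Omega}F(x)$ is a point $x^*\in\Omega$ such that for some $\delta>0$, $F(x^* )\le F(x)$ for all $x\in\Omega$ with $\|x-x^*\|\le\delta$. *)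

(* Defs.v *)
From HB Require Import structures.
From mathcomp Require Import all_boot all_order all_algebra.
From mathcomp Require Import all_classical all_reals all_analysis.
Set Implicit Arguments.
Unset Strict Implicit.
Unset Printing Implicit Defensive.
Import Order.TTheory GRing.Theory Num.Theory.
Import numFieldNormedType.Exports.
Local Open Scope classical_set_scope.
Local Open Scope ring_scope.

(* The canonical norm `|x| of 'rV[R]_n is the sup norm, hence this one. *)
Definition euclidean_norm (R : realType) (n : nat) (x : 'rV[R]_n) : R :=
  Num.sqrt (\sum_(i < n) x 0 i ^+ 2).

(* Total: 'D_v f x is a junk value where f is not derivable, so this is only
   meaningful together with [differentiable f x]. *)
Definition gradient (R : realType) (n : nat) (f : 'rV[R]_n -> R)
    (x : 'rV[R]_n) : 'rV[R]_n :=
  \row_(i < n) 'D_(delta_mx 0 i) f x.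

Definition lipschitz_gradient (R : realType) (n : nat) (L : R)
    (f : 'rV[R]_n -> R) : Prop :=
  forall x y : 'rV[R]_n,
    euclidean_norm (gradient f x - gradient f y) <= L * euclidean_norm (x - y).

Definition box (R : realType) (n : nat) (l u : 'I_n -> \bar R) :
    set 'rV[R]_n :=
  [set x | forall i : 'I_n, (l i <= (x 0 i)%:E)%E /\ ((x 0 i)%:E <= u i)%E].

(* ||x_+||_0 *)
Definition pos_l0 (R : realType) (n : nat) (x : 'rV[R]_n) : nat :=
  #|[set i : 'I_n | 0 < x 0 i]%SET|.

(* Gamma(x) *)
Definition supp (R : realType) (n : nat) (x : 'rV[R]_n) : {set 'I_n} :=
  [set i : 'I_n | x 0 i != 0]%SET.

Definition objective (R : realType) (n : nat) (f : 'rV[R]_n -> R)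
    (lambda1 : R) (x : 'rV[R]_n) : R :=
  f x + lambda1 * (pos_l0 x)%:R.

(* Omega_{s*}, for s* determined by xs *)
Definition restricted_box (R : realType) (n : nat) (l u : 'I_n -> \bar R)
    (xs : 'rV[R]_n) : set 'rV[R]_n :=
  [set x | box l u x /\ forall i : 'I_n, i \in (~: supp xs)%SET -> x 0 i <= 0].

Definition local_minimizer (R : realType) (n : nat) (F : 'rV[R]_n -> R)
    (A : set 'rV[R]_n) (xs : 'rV[R]_n) : Prop :=
  A xs /\ exists2 delta : R, 0 < delta &
    forall x : 'rV[R]_n, A x -> euclidean_norm (x - xs) <= delta -> F xs <= F x.

Definition global_minimizer (R : realType) (n : nat) (F : 'rV[R]_n -> R)
    (A : set 'rV[R]_n) (xs : 'rV[R]_n) : Prop :=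
  A xs /\ forall x : 'rV[R]_n, A x -> F xs <= F x.

(* Main.v *)
Require Import Defs.
From HB Require Import structures.
From mathcomp Require Import all_boot all_order all_algebra.
From mathcomp Require Import all_classical all_reals all_analysis.
Import Order.TTheory GRing.Theory Num.Theory.
Import numFieldNormedType.Exports.
Local Open Scope classical_set_scope.
Local Open Scope ring_scope.

(** Close to [xs] the coordinates that are nonzero at [xs] keep their sign, so
    the penalty [lambda1 * pos_l0] can only grow, and it grows exactly when some
    coordinate that vanishes at [xs] becomes positive, that is, when a point of
    the box lies outside the restricted box (lemma [near_pos_l0_leqif]).

    Inside the restricted box the penalty is therefore locally constant, so a
    local minimizer of the objective is a local minimizer of [f] there; the
    restricted box being convex, convexity of [f] makes it a global one (lemma
    [convex_local_min_global]).

    Conversely, a nearby point of the box outside the restricted box pays at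
    least one extra [lambda1 > 0], which outweighs the small variation of the
    continuous function [f]; a point inside the restricted box is covered by
    global minimality and the monotonicity of the penalty. *)

(** The Euclidean norm is equivalent to the sup norm, so its closed balls form
    a basis of the topology of row vectors. This turns the epsilon-delta
    definition of a local minimizer into a neighborhood statement. *)
Lemma nbhs_euclideanP (R : realType) (n : nat) (x0 : 'rV[R]_n)
    (P : set 'rV[R]_n) :
  nbhs x0 P <->
  exists2 delta : R, 0 < delta &
    forall x, euclidean_norm (x - x0) <= delta -> P x.
Proof.
split=> [/nbhs_ballP[e /= e0 eP]|[d d0 dP]].
  exists (e / 2); first by rewrite divr_gt0.
  move=> x xe; apply: eP; split=> // i j; rewrite ord1 /ball/= distrC.
  apply: le_lt_trans (_ : e / 2 < e); last first.
    by rewrite ltr_pdivrMr// mulr_natr mulr2n ltrDl.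
  apply: le_trans xe; rewrite -sqrtr_sqr ler_sqrt; last first.
    by apply: sumr_ge0 => k _; exact: sqr_ge0.
  rewrite (bigD1 j)//= !mxE lerDl.
  by apply: sumr_ge0 => k _; exact: sqr_ge0.
(* n.+1 rather than n: the radius has to make sense in dimension 0 too *)
have e0 : 0 < d / n.+1%:R by rewrite divr_gt0.
apply/nbhs_ballP; exists (d / n.+1%:R) => //= x [_ xe]; apply: dP.
rewrite -(ger0_norm (ltW d0)) -sqrtr_sqr ler_sqrt ?sqr_ge0//.
apply: le_trans (_ : \sum_(i < n) (d / n.+1%:R) ^+ 2 <= _).
  apply: ler_sum => i _; rewrite -real_normK ?num_real// !mxE distrC.
  by rewrite lerXn2r// ?nnegrE ?(ltW e0)// ltW//; exact: xe.
rewrite sumr_const card_ord -[_ *+ n]mulr_natr expr_div_n -mulrA.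
rewrite ler_piMr ?sqr_ge0//.
rewrite mulrC ler_pdivrMr ?exprn_gt0// mul1r -natrX ler_nat.
by apply: leq_trans (leqnSn n) _; rewrite leq_pmull.
Qed.

Lemma local_minimizerP (R : realType) (n : nat) (F : 'rV[R]_n -> R)
    (A : set 'rV[R]_n) (x0 : 'rV[R]_n) :
  local_minimizer F A x0 <->
  A x0 /\ \forall x \near x0, A x -> F x0 <= F x.
Proof.
split=> -[Ax0]; last first.
  move=> /nbhs_euclideanP[d d0 dP]; split=> //; exists d => // x Ax xd.
  exact: dP.
move=> [d d0 dP]; split=> //; apply/nbhs_euclideanP; exists d => // x xd Ax.
exact: dP.
Qed.

Lemma near_coord_sign (R : realType) (n : nat) (x0 : 'rV[R]_n) :
  nbhs x0 [set x : 'rV[R]_n | forall i : 'I_n,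
    (0 < x0 0 i -> 0 < x 0 i) /\ (x0 0 i < 0 -> x 0 i < 0)].
Proof.
apply: (@filter_forall _ _ _ _ (nbhs_filter x0)) => i.
have ci : (fun x : 'rV[R]_n => x 0 i) x @[x --> x0] --> x0 0 i.
  exact: coord_continuous.
have [x0i|x0i|x0i] := ltgtP (x0 0 i) 0.
- by near=> x; split=> // _; near: x; exact: (cvgr_lt _ ci).
- by near=> x; split=> // _; near: x; exact: (cvgr_gt _ ci).
- by near=> x; split.
Unshelve. all: by end_near. Qed.

(** Nonzero coordinates keep their sign near [x0], so the positivity pattern
    of a nearby point contains that of [x0] and differs from it only by zero
    coordinates of [x0] that have become positive. *)
Lemma near_pos_l0_leqif (R : realType) (n : nat) (x0 : 'rV[R]_n) :
  \forall x \near x0,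
    (pos_l0 x0 <= pos_l0 x ?= iff
      [forall i in (~: supp x0)%SET, (x 0 i <= 0)%R])%N.
Proof.
near=> x.
have sx : forall i : 'I_n,
    (0 < x0 0 i -> 0 < x 0 i) /\ (x0 0 i < 0 -> x 0 i < 0).
  by near: x; exact: near_coord_sign.
have sub : ([set i | (0 < x0 0 i)%R] \subset [set i | (0 < x 0 i)%R])%SET.
  by apply/fintype.subsetP => i; rewrite !inE; exact: (sx i).1.
suff <- : ([set i | (0 < x0 0 i)%R] == [set i | (0 < x 0 i)%R])%SET =
    [forall i in (~: supp x0)%SET, (x 0 i <= 0)%R].
  exact: subset_leqif_cards.
apply/eqP/forall_inP => [eq_pos i|npos].
  rewrite !inE negbK => /eqP x0i; rewrite leNgt; apply/negP => xi.
  have : i \in [set i | (0 < x 0 i)%R]%SET by rewrite inE.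
  by rewrite -eq_pos inE x0i ltxx.
apply/setP => i; rewrite !inE.
have [x0i|x0i|x0i] := ltgtP (x0 0 i) 0.
- by rewrite ltNge ltW// (sx i).2.
- by rewrite (sx i).1.
- by rewrite ltNge npos// !inE negbK x0i.
Unshelve. all: by end_near. Qed.

(** A point slightly off [x0] on the segment from [x0] to a competitor [x] is
    no better than [x0], yet [f] there is at most a mean of [f x0] and [f x]
    with positive weight on [f x]; hence [f x] is at least [f x0]. *)
Lemma convex_local_min_global (R : realType) (V : normedModType R)
    (f : V -> R) (A : set V) (x0 : V) :
  convex_function setT f -> convex_set A -> A x0 ->
  (\forall x \near x0, A x -> f x0 <= f x) ->
  forall x, A x -> f x0 <= f x.
Proof.
move=> fconv Aconv Ax0 fmin x Ax.
have cvg_seg : (t *: x + (1 - t) *: x0) @[t --> (0 : R)] --> x0.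
  have : (t *: x + (1 - t) *: x0) @[t --> (0 : R)] --> 0 *: x + (1 - 0) *: x0.
    apply: cvgD; apply: cvgZr_tmp; first exact: cvg_id.
    by apply: cvgB; [exact: cvg_cst|exact: cvg_id].
  by rewrite scale0r add0r subr0 scale1r.
near (0 : R)^'+ => t.
have t0 : 0 < t by [].
have t1 : t <= 1 by near: t; exact: nbhs_right_le.
have near_min : A (t *: x + (1 - t) *: x0) ->
    f x0 <= f (t *: x + (1 - t) *: x0).
  near: t; exact: cvg_at_right_filter cvg_seg _ fmin.
have := Aconv x x0 (Itv01 (ltW t0) t1) (mem_set Ax) (mem_set Ax0).
rewrite inE => /near_min.
have := fconv (Itv01 (ltW t0) t1) x x0 (mem_set I) (mem_set I).
move=> /[swap] /le_trans/[apply]; rewrite convRE /unstable.onem.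
by rewrite mulrBl mul1r addrCA lerDl -mulrBr pmulr_rge0// subr_ge0.
Unshelve. all: by end_near. Qed.

(** On the real line a convex combination lies between its two points, so each
    bound on a coordinate passes to it from one of them, whether that bound is
    finite or infinite. *)
Lemma convex_restricted_box (R : realType) (n : nat) (l u : 'I_n -> \bar R)
    (x0 : 'rV[R]_n) : convex_set (restricted_box l u x0).
Proof.
move=> x y t; rewrite !inE => -[xbox xnpos] [ybox ynpos].
have between (i : 'I_n) : let z := (conv t x y : 'rV[R]_n) 0 i in
    x 0 i <= z <= y 0 i \/ y 0 i <= z <= x 0 i.
  rewrite /= !mxE; have [xy|/ltW yx] := leP (x 0 i) (y 0 i).
    by left; exact: (convR_itv t xy).
  right; rewrite -[_ + _]/(conv t (x 0 i : R^o) (y 0 i)) convC.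
  exact: convR_itv.
split=> i.
  have [lx xu] := xbox i; have [ly yu] := ybox i.
  have [/andP[xz zy]|/andP[yz zx]] := between i; split.
  - by apply: le_trans lx _; rewrite lee_fin.
  - by apply: le_trans yu; rewrite lee_fin.
  - by apply: le_trans ly _; rewrite lee_fin.
  - by apply: le_trans xu; rewrite lee_fin.
move=> iP; have [/andP[_ zy]|/andP[_ zx]] := between i.
- exact: le_trans zy (ynpos i iP).
- exact: le_trans zx (xnpos i iP).
Qed.

Theorem proposition3p2 (R : realType) (n : nat) (f : 'rV[R]_n -> R) (Lf : R)
    (l u : 'I_n -> \bar R) (lambda1 : R) (xs : 'rV[R]_n)
    (f_convex : convex_function setT f)
    (f_diff : forall x : 'rV[R]_n, differentiable f x)
    (f_grad : lipschitz_gradient Lf f)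
    (l_le0 : forall i : 'I_n, (l i <= 0)%E)
    (u_ge0 : forall i : 'I_n, (0 <= u i)%E)
    (l_lt_u : forall i : 'I_n, (l i < u i)%E)
    (lambda1_gt0 : 0 < lambda1)
    (xs_box : box l u xs) :
  local_minimizer (objective f lambda1) (box l u) xs <->
  global_minimizer f (restricted_box l u xs) xs.
Proof.
have xs_restricted : restricted_box l u xs xs.
  by split=> // i; rewrite !inE negbK => /eqP ->.
split=> [/local_minimizerP[_ Fmin]|[_ fmin]].
  split=> //; apply: convex_local_min_global => //.
    exact: convex_restricted_box.
  near=> x => -[xbox xs0].
  have Fx : box l u x -> objective f lambda1 xs <= objective f lambda1 x.
    by near: x.
  have penalty : (pos_l0 xs <= pos_l0 x ?= iff
      [forall i in (~: supp xs)%SET, (x 0 i <= 0)%R])%N.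
    by near: x; exact: near_pos_l0_leqif.
  have /eqP same_penalty : (pos_l0 xs == pos_l0 x)%N.
    by rewrite penalty; apply/forall_inP.
  by have := Fx xbox; rewrite /objective same_penalty lerD2r.
apply/local_minimizerP; split=> //; near=> x => xbox.
have penalty : (pos_l0 xs <= pos_l0 x ?= iff
    [forall i in (~: supp xs)%SET, (x 0 i <= 0)%R])%N.
  by near: x; exact: near_pos_l0_leqif.
have [/forall_inP xs0|outside] :=
    boolP [forall i in (~: supp xs)%SET, (x 0 i <= 0)%R].
  rewrite /objective lerD//; first exact: fmin.
  by rewrite ler_pM2l// ler_nat penalty.
have extra : ((pos_l0 xs).+1 <= pos_l0 x)%N.
  by rewrite (ltn_leqif penalty).
(* continuity of [f]: moving off [xs] gains less than one penalty unit *)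
have close : f xs - lambda1 < f x.
  near: x; apply: (cvgr_gt (f xs)); last by rewrite ltrBlDr ltrDl.
  exact: differentiable_continuous.
rewrite /objective; apply: (@le_trans _ _ (f x + lambda1 * (pos_l0 xs).+1%:R)).
  by rewrite -natr1 mulrDr mulr1 addrA addrAC lerD2r -lerBlDr ltW.
by rewrite lerD2l ler_pM2l// ler_nat.
Unshelve. all: by end_near. Qed.
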